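(* Let $p$ be a prime number and $0\neq f(t)\in\mathbb{Z}[t]$. Then the $p$-power-th cyclic resultants $\mathrm{Res}(t^{p^n}-1,f(t))$ converge in $\mathbb{Z}_p$ as $n\to\infty$, and the limit is $0$ if and only if $p\mid f(1)$. In any case, if $\mathrm{Res}(t^{p^n}-1,f(t))\neq 0$ for every $n$, then the non-$p$-parts of $\mathrm{Res}(t^{p^n}-1,f(t))$ converge in $\mathbb{Z}_p$ to a non-zero value. Moreover, for each prime number $l$, similar assertions hold for the $l$-parts of $\mathrm{Res}(t^{p^n}-1,f(t))$; in particular these $l$-parts converge in $\mathbb{Z}_p$.
   Context: For $n\in\mathbb{Z}_{>0}$, $\mathrm{Res}(t^n-1,f(t))=\prod_{\zeta^n=1}f(\zeta)$, the product over all $n$-th roots of unity in $\overline{\mathbb{Q}}$; it is an integer. The non-$p$ part of a nonzero integer $x=mp^r$ with $p\nmid m$, $r\ge0$, is $m$ (i.e. $x\,|x|_p$). For a prime $l$, the $l$-part of a nonzero integer $x$ is the largest power of $l$ dividing $x$, i.e. $|x|_l^{-1}$. *)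

(* Defs.v *)
From HB Require Import structures.
From mathcomp Require Import all_boot all_order all_algebra all_field.
Set Implicit Arguments. Unset Strict Implicit. Unset Printing Implicit Defensive.
Import Order.TTheory GRing.Theory Num.Theory.
Local Open Scope ring_scope.

(* Cyclic resultant Res(t^n - 1, f) = prod_{zeta^n = 1} f(zeta), computed in
   the algebraic numbers algC.  For n > 0 the n-th roots of unity are exactly
   w^i (i < n) for a primitive n-th root w. (n = 0 is never used.) *)
Definition cres_C (n : nat) (f : {poly int}) : algC :=
  match n with
  | 0 => 1
  | m.+1 =>
      let w := sval (C_prim_root_exists (ltn0Sn m)) in
      \prod_(i < m.+1) (map_poly intr f).[w ^+ i]
  end.

(* The same value as an integer (it is an integer, so floor is exact). *)
Definition cres (n : nat) (f : {poly int}) : int := Num.floor (cres_C n f).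

Definition nonp_part (p : nat) (x : int) : int :=
  (x %/ (p ^ logn p `|x|%N)%:Z)%Z.

Definition l_part (l : nat) (x : int) : int := (l ^ logn l `|x|%N)%:Z.

(* Z_p modelled as the inverse limit of Z/p^k: an element is a compatible
   family of residues x k in [0, p^k). *)
Definition is_Zp (p : nat) (x : nat -> int) : Prop :=
  forall k : nat, (0 <= x k < (p ^ k)%:Z) /\ (x k.+1 = x k %[mod (p ^ k)%:Z])%Z.

Definition padic_lim (p : nat) (a : nat -> int) (x : nat -> int) : Prop :=
  is_Zp p x /\
  forall k : nat, exists N : nat, forall n : nat, (N <= n)%N ->
    (a n = x k %[mod (p ^ k)%:Z])%Z.

Definition Zp_zero (x : nat -> int) : Prop := forall k, x k = 0.

(* Main.v *)
(* Res(t^q - 1, f) is the determinant of the circulant matrix of f of order q.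
   By the Smith normal form, the kernel of this matrix modulo m -- the q-periodic
   sequences in Z/m annihilated by f(shift) -- has as many elements as the part
   of the resultant dividing m.  The shift acts on the kernel for q = p^(n+1);
   the points fixed by its p^n-th power form the kernel for q = p^n and all other
   orbits have p^(n+1) elements.  Hence the absolute values of consecutive
   resultants, and likewise their pi-parts for any set pi of primes, are congruent
   modulo p^(n+1).  Pairing conjugate roots of unity shows that the sign is
   constant for n > 0.  Finally, if p | f(1) then 1 - z divides f(z) for every
   p-power root of unity z <> 1, so that p^n = prod (1 - z) divides the
   resultant. *)
Require Import Defs.
From HB Require Import structures.
From mathcomp Require Import all_boot all_order all_algebra all_field all_fingroup.
Set Implicit Arguments. Unset Strict Implicit. Unset Printing Implicit Defensive.
Import Order.TTheory GRing.Theory Num.Theory.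
Local Open Scope ring_scope.

(** * Counting kernels of integer matrices modulo m *)

(** With g = gcd(d, m), d y vanishes modulo m exactly when m / g divides y, which leaves g classes.
    The type ['Z_m] is Z/m only for 1 < m. *)
Lemma card_annihilator (m d : nat) : (1 < m)%N ->
  #|[pred y : 'Z_m | d%:R * y == 0]| = gcdn d m.
Proof.
move=> m1; have m0 : (0 < m)%N by apply: ltnW.
set g := gcdn d m.
have g0 : (0 < g)%N by rewrite gcdn_gt0 m0 orbT.
have gm : (g %| m)%N := dvdn_gcdr d m.
have mE : (m %/ g * g = m)%N := divnK gm.
have mg0 : (0 < m %/ g)%N by rewrite divn_gt0 // dvdn_leq.
have cardZ : (Zp_trunc m).+2 = m by rewrite Zp_cast.
have annE (y : 'Z_m) : (d%:R * y == 0) = (m %/ g %| y)%N.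
  rewrite -[y in LHS]natr_Zp -natrM.
  have -> : ((d * y)%:R == 0 :> 'Z_m) = (m %| d * y)%N.
    by rewrite -val_eqE /= val_Zp_nat.
  have -> : (m %| d * y)%N = (m %/ g * g %| d %/ g * y * g)%N.
    by rewrite mE mulnAC divnK ?dvdn_gcdl.
  rewrite dvdn_pmul2r // Gauss_dvdr //.
  rewrite /coprime -(eqn_pmul2r g0) mul1n muln_gcdl mE divnK ?dvdn_gcdl //.
  by rewrite gcdnC.
have lt_g (k : 'I_g) : (m %/ g * k < (Zp_trunc m).+2)%N.
  by rewrite cardZ -[X in (_ < X)%N]mE ltn_pmul2l.
pose h (k : 'I_g) : 'Z_m := Ordinal (lt_g k).
rewrite -[RHS](card_ord g) -(card_codom (f := h)); last first.
  move=> k1 k2 /(congr1 val) /= /eqP; rewrite eqn_pmul2l // => /eqP.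
  exact: val_inj.
apply: eq_card => y; rewrite !inE annE; apply/idP/codomP => [yP|[k ->]]; last first.
  by rewrite /= dvdn_mulr.
have lt_y : (y %/ (m %/ g) < g)%N.
  by rewrite ltn_divLR // mulnC mE; have := ltn_ord y; rewrite [X in (_ < X)%N -> _]cardZ.
by exists (Ordinal lt_y); apply: val_inj; rewrite /= mulnC divnK.
Qed.

Definition solutions (m q : nat) (A : 'M[int]_q) : {set 'cV['Z_m]_q} :=
  [set x | map_mx intr A *m x == 0].

Lemma card_solutions_diag (m q : nat) (d : 'I_q -> int) : (1 < m)%N ->
  #|solutions m (\matrix_(i, j) (d i *+ (i == j)))| = (\prod_i gcdn `|d i| m)%N.
Proof.
move=> m1.
have solE (x : 'cV['Z_m]_q) :
    (x \in solutions m (\matrix_(i, j) (d i *+ (i == j)))) =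
    [forall i, (`|d i|%N)%:R * x i 0 == 0].
  rewrite inE; apply/eqP/forallP => [e i|e].
    move/matrixP/(_ i 0): e; rewrite !mxE (bigD1 i) //= big1 ?addr0.
      rewrite !mxE eqxx mulr1n; case: (d i) => n /=; first by move=> ->.
      by rewrite NegzE mulrNz mulNr => /eqP; rewrite oppr_eq0.
    by move=> j ne; rewrite !mxE eq_sym (negPf ne) mul0r.
  apply/matrixP=> i j; rewrite !mxE (bigD1 i) //= big1 ?addr0.
    rewrite !mxE eqxx mulr1n ord1; move: (e i) => /eqP.
    case: (d i) => n /=; first by move=> ->.
    by rewrite NegzE mulrNz mulNr => ->; rewrite oppr0.
  by move=> k ne; rewrite !mxE eq_sym (negPf ne) mul0r.
pose F i := [pred y : 'Z_m | (`|d i|%N)%:R * y == 0].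
transitivity #|family F|.
  rewrite -(card_imset _ (f := fun g : {ffun 'I_q -> 'Z_m} => \col_i g i)).
    apply: eq_card => x; rewrite solE; apply/forallP/imsetP => [e|[g /familyP gF ->] i].
      exists [ffun i => x i 0]; last by apply/matrixP=> i j; rewrite !mxE ffunE ord1.
      by apply/familyP=> i; rewrite ffunE; apply: e.
    by rewrite mxE; have := gF i; rewrite inE.
  by move=> g1 g2 /matrixP e; apply/ffunP=> i; have := e i 0; rewrite !mxE.
rewrite card_family foldrE big_map big_enum /=.
by apply: eq_bigr => i _; rewrite card_annihilator.
Qed.

(** Unimodular matrices stay invertible modulo m, so for the Smith form A = L D U the map U sends
    the solutions for A bijectively to those for D. The family d serves all m and may contain
    zeros. *)
Lemma card_solutions (q : nat) (A : 'M[int]_q) :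
  exists2 d : 'I_q -> nat, `|\det A|%N = (\prod_i d i)%N &
  forall m, (1 < m)%N -> #|solutions m A| = (\prod_i gcdn (d i) m)%N.
Proof.
have [L uL [U uU [d _ AE]]] := int_Smith_normal_form A.
set D := (\matrix_(i, j) _) in AE.
exists (fun i => `|(d`_i)%R|%N) => [|m m1].
  have det1 (B : 'M[int]_q) : B \in unitmx -> `|\det B|%N = 1%N.
    rewrite unitmxE => /unitrP[y [_ /(congr1 absz)]].
    by rewrite abszM => /eqP; rewrite muln_eq1 => /andP[/eqP].
  have DE : D = diag_mx (\row_i d`_i) by apply/matrixP=> i j; rewrite !mxE.
  rewrite AE !det_mulmx !abszM (det1 L) // (det1 U) // mul1n muln1 DE det_diag.
  rewrite (big_morph absz abszM (erefl : `|1%:Z|%N = 1%N)).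
  by apply: eq_bigr => i _; rewrite mxE.
rewrite -(card_solutions_diag (fun i => d`_i) m1) -/D.
have mapu (B : 'M[int]_q) : B \in unitmx -> map_mx intr B \in @unitmx 'Z_m q.
  by rewrite !unitmxE det_map_mx; apply: rmorph_unit.
have inj : injective (mulmx (map_mx intr U) : 'cV['Z_m]_q -> 'cV_q).
  by apply: can_inj (mulKmx _); apply: mapu.
suff -> : solutions m D = mulmx (map_mx intr U) @: solutions m A.
  exact/esym/card_imset.
apply/setP=> y; rewrite [LHS]inE; apply/eqP/imsetP => [e|[x + ->]]; last first.
  rewrite inE AE !map_mxM -!mulmxA => /eqP e.
  by rewrite -[_ *m (_ *m _)](mulKmx (mapu _ uL)) e mulmx0.
exists (invmx (map_mx intr U) *m y); last by rewrite mulKVmx // mapu.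
by rewrite inE AE !map_mxM -!mulmxA mulKVmx ?mapu // e mulmx0.
Qed.

(** For a nonzero determinant every d i divides m, so each gcd is d i itself. Otherwise some d i is
    0 and contributes the factor m, a multiple of r, so both sides vanish modulo r. *)
Lemma card_solutions_mod (q : nat) (A : 'M[int]_q) (r m : nat) :
  (1 < m)%N -> (r %| m)%N -> (\det A != 0 -> `|\det A| %| m)%N ->
  (`|\det A| = #|solutions m A| %[mod r])%N.
Proof.
move=> m1 rm dm; have [d detE cardE] := card_solutions A.
rewrite cardE // detE; have [det0|ndet0] := eqVneq (\det A) 0.
  have [/existsP[i /eqP di0]|/existsPn dn0] := boolP [exists i, d i == 0%N]; last first.
    have : (0 < \prod_i d i)%N by apply: prodn_gt0 => i; rewrite lt0n.
    by rewrite -detE det0.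
  rewrite (bigD1 i) //= [in RHS](bigD1 i) //= di0 mul0n gcd0n mod0n.
  by apply/esym/eqP; rewrite -/(dvdn _ _) dvdn_mulr.
have {}dm := dm ndet0; congr (_ %% _)%N; apply: eq_bigr => i _.
apply/esym/gcdn_idPl; apply: dvdn_trans dm; rewrite detE.
by rewrite (bigD1 i) //= dvdn_mulr.
Qed.

(** As m is a pi-number, gcd(d i, m) sees only the pi-part of d i, and this part divides m. *)
Lemma card_solutions_part (q : nat) (A : 'M[int]_q) (pi : nat_pred) (m : nat) :
  (1 < m)%N -> \det A != 0 -> pi.-nat m -> (`|\det A|`_pi %| m)%N ->
  #|solutions m A| = (`|\det A|`_pi)%N.
Proof.
move=> m1 nz pim dm; have [d detE cardE] := card_solutions A.
have dgt0 i : (0 < d i)%N.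
  move: nz; rewrite -absz_eq0 detE -lt0n; apply: contraTltn.
  by rewrite leqn0 => /eqP di; rewrite (bigD1 i) //= di mul0n.
have partE : ((\prod_i d i)`_pi = \prod_i (d i)`_pi)%N.
  apply: (big_ind2 (fun x y : nat => (0 < x)%N -> (x`_pi)%N = y)) => //.
  - by rewrite partn1.
  - move=> x1 x2 y1 y2 e1 e2; rewrite muln_gt0 => /andP[x0 y0].
    by rewrite partnM // e1 // e2.
  - by apply: prodn_gt0.
rewrite cardE // detE partE; apply: eq_bigr => i _.
rewrite -{1}(partnC pi (dgt0 i)) gcdnC Gauss_gcdl; last first.
  by apply: (pnat_coprime pim); apply: part_pnat.
apply/gcdn_idPr; apply: dvdn_trans dm.
by rewrite detE partE (bigD1 i) //= dvdn_mulr.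
Qed.

(** * The shift action on circulant kernels *)

(** An orbit size divides p^(n+1); a proper divisor would divide p^n and make the orbit fixed by the
    p^n-th iterate. All orbits left thus have exactly p^(n+1) elements. *)
Lemma dvdn_card_free_orbits (T : finType) (s : {perm T}) (S : {set T}) (p n : nat) :
  prime p -> (forall x, x \in S -> s x \in S) ->
  (forall x, iter (p ^ n.+1) s x = x) ->
  (p ^ n.+1 %| #|S :\: [set x | iter (p ^ n) s x == x]|)%N.
Proof.
move=> pr_p sS sper; set D := S :\: _.
have iterC k x : iter k s (s x) = s (iter k s x) by rewrite -iterSr.
have sD x : x \in D -> s x \in D.
  rewrite !inE => /andP[nfix xS]; rewrite sS // andbT iterC.
  by apply: contraNneq nfix => /perm_inj ->.
have actD : [acts <[s]>%g, on D | 'P].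
  rewrite gen_subG sub1set; apply/astabsP=> x /=; rewrite apermE.
  apply/idP/idP => [sxD|]; last exact: sD.
  (* The inverse of s is an iterate of s, so stability under s also runs backwards. *)
  have -> : x = iter (p ^ n.+1).-1 s (s x).
    by rewrite -iterSr prednK ?expn_gt0 ?prime_gt0.
  by elim: _.-1 => //= k; apply: sD.
rewrite -(acts_sum_card_orbit actD); apply: dvdn_sum => _ /imsetP[x xD ->].
suff -> : #|orbit 'P <[s]>%g x| = (p ^ n.+1)%N by [].
rewrite -porbitE; set c := #|porbit s x|.
have c0 : (0 < c)%N by rewrite lt0n card_porbit_neq0.
have min_c r : (r < c)%N -> iter r s x = x -> r = 0%N.
  move=> rc; have := uniq_traject_porbit s x; rewrite -/c => /uniqP.
  move=> /(_ x r 0%N); rewrite !inE !size_traject => /(_ rc c0).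
  by rewrite !nth_traject // => H /H.
have iter_modc k : iter k s x = iter (k %% c) s x.
  rewrite {1}(divn_eq k c) addnC iterD; congr (iter _ _ _).
  by elim: (k %/ c)%N => // j IHj; rewrite mulSn iterD IHj iter_porbit.
have dvd_c k : iter k s x = x -> (c %| k)%N.
  rewrite iter_modc => /min_c H; apply/eqP/H.
  by rewrite ltn_mod.
have [j le_j cE] : exists2 j, (j <= n.+1)%N & c = (p ^ j)%N.
  by apply/dvdn_pfactor => //; apply: dvd_c.
move: le_j; rewrite leq_eqVlt => /orP[/eqP <- //|le_j].
move: xD; rewrite !inE iter_modc cE.
by have /eqP -> : (p ^ j %| p ^ n)%N; rewrite ?eqxx // dvdn_exp2l.
Qed.

(** The matrix of multiplication by f on Z[t]/(t^(q+1) - 1): row i holds t^i f. Exponents are folded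
    modulo q+1, so the degree of f is arbitrary. *)
Definition circulant (q : nat) (f : {poly int}) : 'M[int]_q.+1 :=
  \matrix_(i, j) \sum_(k < size f | inZp (i + k) == j) f`_k.

Lemma solutions_circulantP (m q : nat) (f : {poly int}) (x : 'cV['Z_m]_q.+1) :
  reflect (forall i : 'I_q.+1,
             \sum_(k < size f) (f`_k)%:~R * x (inZp (i + k)) 0 = 0)
          (x \in solutions m (circulant q f)).
Proof.
have mxE i : (map_mx intr (circulant q f) *m x) i 0 =
             \sum_(k < size f) (f`_k)%:~R * x (inZp (i + k)) 0.
  rewrite mxE (partition_big (fun k : 'I_(size f) => inZp (i + k) : 'I_q.+1) xpredT) //=.
  apply: eq_bigr => j _; rewrite !mxE rmorph_sum mulr_suml.
  by apply: eq_bigr => k /eqP ->.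
rewrite inE; apply: (iffP eqP) => [e i|e].
  by rewrite -mxE e !matrix.mxE.
by apply/matrixP=> i j; rewrite ord1 mxE e matrix.mxE.
Qed.

Lemma card_solutions_circulant (p n m q q' : nat) (f : {poly int}) :
  prime p -> q.+1 = (p ^ n.+1)%N -> q'.+1 = (p ^ n)%N ->
  (#|solutions m (circulant q f)| = #|solutions m (circulant q' f)|
     %[mod p ^ n.+1])%N.
Proof.
move=> pr_p qE q'E.
have q'q : (q'.+1 %| q.+1)%N by rewrite qE q'E dvdn_exp2l.
pose sh (x : 'cV['Z_m]_q.+1) := \col_i x (inZp i.+1) 0 : 'cV['Z_m]_q.+1.
have iterE k x : iter k sh x = \col_i x (inZp (i + k)) 0.
  elim: k x => [|k IHk] x /=.
    by apply/matrixP=> i j; rewrite mxE ord1 addn0 valZpK.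
  apply/matrixP=> i j; rewrite IHk !mxE; congr (x _ _); apply: val_inj => /=.
  by rewrite modnDml addSnnS.
have sh_per x : iter q.+1 sh x = x.
  apply/matrixP=> i j; rewrite iterE mxE ord1; congr (x _ _).
  by apply: val_inj; rewrite /= modnDr modn_small.
have sh_inj : injective sh.
  by apply: (can_inj (g := iter q sh)) => x; rewrite -iterSr sh_per.
pose s := perm sh_inj.
have iter_s k x : iter k s x = iter k sh x.
  by elim: k => //= k ->; rewrite permE.
set S := solutions m (circulant q f).
have /(dvdn_card_free_orbits pr_p) H x : x \in S -> s x \in S.
  move=> /solutions_circulantP e; apply/solutions_circulantP => i; rewrite permE.
  rewrite -[RHS](e (inZp i.+1)); apply: eq_bigr => k _; congr (_ * _).
  rewrite mxE; congr (x _ _); apply: val_inj; rewrite /= modnDml.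
  by rewrite -[(_ %% _).+1]addn1 modnDml addn1.
move/(_ n): H; set Fix := [set x | _]; rewrite -qE => /(_ _)/eqP Hmod.
rewrite -(cardsID Fix S) -modnDmr Hmod; last by move=> x; rewrite iter_s sh_per.
rewrite addn0; congr (_ %% _)%N.
(* [h] reads a sequence of period p^n as one of period p^(n+1); it maps the smaller kernel onto the
   fixed part of the larger one. *)
pose h (y : 'cV['Z_m]_q'.+1) : 'cV['Z_m]_q.+1 := \col_i y (inZp i) 0.
have h_inj : injective h.
  move=> y1 y2 /matrixP e; apply/matrixP=> i j; rewrite ord1.
  have := e (inZp i) 0; rewrite !mxE.
  suff -> : inZp (inZp i : 'I_q.+1) = i :> 'I_q'.+1 by [].
  by apply: val_inj; rewrite /= modn_dvdm // modn_small.
rewrite -(card_imset _ h_inj); apply: eq_card => x.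
apply/idP/imsetP => [|[y /solutions_circulantP e ->]]; last first.
  rewrite in_setI; apply/andP; split.
    apply/solutions_circulantP=> i; rewrite -[RHS](e (inZp i)).
    apply: eq_bigr => k _; rewrite mxE; congr (_ * y _ _).
    by apply: val_inj; rewrite /= modn_dvdm // modnDml.
  rewrite inE iter_s iterE; apply/eqP/matrixP=> i j; rewrite !mxE; congr (y _ _).
  by apply: val_inj; rewrite /= modn_dvdm // -q'E modnDr.
rewrite in_setI => /andP[/solutions_circulantP e]; rewrite inE iter_s => /eqP xfix.
have iter_fix k : iter (k * p ^ n) sh x = x.
  by elim: k => // k IHk; rewrite mulSn iterD IHk xfix.
(* Invariance under the p^n-fold shift makes x depend on the index modulo p^n only, so its first p^n
   entries form the preimage. *)
have xE (i : nat) : x (inZp (i %% q'.+1)) 0 = x (inZp i) 0.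
  rewrite -[in LHS](iter_fix (i %/ q'.+1)%N) iterE mxE; congr (x _ _).
  by apply: val_inj; rewrite /= modnDml -q'E addnC -divn_eq.
exists (\col_i x (inZp i) 0); last first.
  by apply/matrixP=> i j; rewrite ord1 !mxE /= xE valZpK.
apply/solutions_circulantP=> i; rewrite -[RHS](e (inZp i)).
apply: eq_bigr => k _; rewrite mxE; congr (_ * _).
rewrite /= xE; congr (x _ _); apply: val_inj.
by rewrite /= modnDml.
Qed.

(** * Cyclic resultants as circulant determinants *)

Local Notation algC_poly := (map_poly (intr : int -> algC)).

(** The Vandermonde columns with entries w^(a i) are eigenvectors of the circulant for the
    eigenvalues f(w^a). The powers of w are distinct, so the Vandermonde determinant is nonzero and
    cancels. *)
Lemma cres_C_circulant (q : nat) (f : {poly int}) :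
  cres_C q.+1 f = (\det (circulant q f))%:~R.
Proof.
rewrite /cres_C; case: C_prim_root_exists => w /= prw.
set fC := map_poly _ f.
pose V := Vandermonde q.+1 (\row_(i < q.+1) w ^+ i).
pose A := map_mx (intr : int -> algC) (circulant q f).
have AV : A *m V = V *m diag_mx (\row_(i < q.+1) fC.[w ^+ i]).
  apply/matrixP=> i a; rewrite mul_mx_diag !mxE.
  rewrite horner_coef size_map_inj_poly ?rmorph0 //; last exact: intr_inj.
  rewrite mulr_sumr
    (partition_big (fun k : 'I_(size f) => inZp (i + k) : 'I_q.+1) xpredT) //=.
  apply: eq_bigr => j _; rewrite !mxE rmorph_sum mulr_suml.
  apply: eq_bigr => k /eqP <-; rewrite coef_map mulrCA; congr (_ * _).
  by rewrite -exprD -!exprM -(prim_expr_mod prw) modnMmr prim_expr_mod.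
have detV : \det V != 0.
  rewrite det_Vandermonde; apply/prodf_neq0 => i _; apply/prodf_neq0 => j lt_ij.
  rewrite !mxE subr_eq0 (eq_prim_root_expr prw) !modn_small //.
  by apply: contraTneq lt_ij => ->; rewrite ltnn.
move/(congr1 determinant): AV; rewrite !det_mulmx det_diag mulrC => /(mulfI detV).
by rewrite det_map_mx => ->; apply: eq_bigr => i _; rewrite mxE.
Qed.

Lemma cres_circulant (q : nat) (f : {poly int}) :
  cres q.+1 f = \det (circulant q f).
Proof. by rewrite /cres cres_C_circulant intrKfloor. Qed.

Lemma cres_prim_root (q : nat) (f : {poly int}) :
  exists2 w : algC, q.+1.-primitive_root w &
    (cres q.+1 f)%:~R = \prod_(i < q.+1) (algC_poly f).[w ^+ i].
Proof.
rewrite cres_circulant -cres_C_circulant /cres_C.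
by case: C_prim_root_exists => w /= prw; exists w.
Qed.

(** * Complex conjugation and the sign of the resultants *)

Lemma horner_root_conj (n : nat) (z : algC) (f : {poly int}) : (0 < n)%N ->
  z ^+ n = 1 -> (algC_poly f).[z^-1] = ((algC_poly f).[z])^*.
Proof.
move=> n0 zn; have nz : `|z| = 1.
  by apply/eqP; rewrite -(@pexpr_eq1 _ _ n) // -normrX zn normr1.
rewrite invC_norm nz expr1n invr1 mul1r -horner_map -map_poly_comp.
by congr _.[_]; apply: eq_map_poly => x /=; rewrite rmorph_int.
Qed.

(** The first and last factors multiply to |G 0|^2. Peeling off such pairs leaves a middle factor
    only for odd q. *)
Lemma prod_conj_sym (q : nat) (G : nat -> algC) :
  (forall i, (i < q)%N -> G (q - i.+1)%N = (G i)^*) ->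
  exists2 P, 0 <= P & \prod_(i < q) G i = (if odd q then G q./2 else 1) * P.
Proof.
have [r] := ubnP q; elim: r q G => // r IHr [|[|q]] G lt_qr symG.
- by exists 1; rewrite ?ler01 // big_ord0 mulr1.
- by exists 1; rewrite ?ler01 // big_ord1 mulr1.
have [| i lt_iq | P P0 eP] := IHr q (fun i => G i.+1); first exact: ltnW.
  by rewrite subnSK // -symG ?subSS // ltnS ltnW.
exists (P * `|G 0%N| ^+ 2); first by rewrite mulr_ge0 ?exprn_ge0.
rewrite big_ord_recl big_ord_recr /= (eq_bigr (fun i : 'I_q => G i.+1)) // eP.
rewrite /= negbK normCK -symG // subn1 /=.
by rewrite -!mulrA mulrCA [G 0%N * _]mulrCA.
Qed.

(* Only the real roots of unity 1 and -1 can make a cyclic resultant negative. *)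
Lemma cres_sign (p : nat) (f : {poly int}) : prime p ->
  (* The sign is that of f(1), times f(-1) when p = 2; the exponent n+1 keeps -1 among the roots of
     unity in that case. *)
  exists s : int, forall n : nat, cres (p ^ n.+1) f = s * `|cres (p ^ n.+1) f|%N.
Proof.
move=> pr_p; pose c := f.[1] * (if odd p then 1 else f.[-1]).
exists (sgz c) => n.
have q0 : (0 < p ^ n.+1)%N by rewrite expn_gt0 prime_gt0.
have oddq : odd (p ^ n.+1) = odd p by rewrite oddX.
have q1 : (1 < p ^ n.+1)%N by rewrite -(exp1n n.+1) ltn_exp2r // prime_gt1.
rewrite -oddq {oddq} in c *; move: (p ^ n.+1)%N q0 q1 @c => [|q] // _ q1 c.
have [w prw RE] := cres_prim_root q f.
have w0 : w != 0.
  apply/eqP=> w0; have := prim_expr_order prw.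
  by move/eqP; rewrite w0 expr0n eq_sym oner_eq0.
set fC := algC_poly f in RE; pose F i := fC.[w ^+ i].
have FJ i : (i <= q.+1)%N -> F (q.+1 - i)%N = (F i)^*.
  move=> iq; rewrite /F -(@horner_root_conj q.+1) //; last first.
    by rewrite -exprM mulnC exprM (prim_expr_order prw) expr1n.
  congr _.[_]; apply: (mulfI (x := w ^+ i)); last first.
    rewrite -exprD subnKC // (prim_expr_order prw) mulfV //.
    by rewrite expf_neq0.
  by rewrite expf_neq0.
have hornerC (z : int) : fC.[z%:~R] = (f.[z])%:~R by rewrite horner_map.
suff [P P0 eP] : exists2 P : algC, 0 <= P & (cres q.+1 f)%:~R = c%:~R * P.
  have [c0|c0|c0] := sgzP c.
  - by apply: (@intr_inj algC); rewrite eP c0 !mul0r.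
  - rewrite mul1r gez0_abs // -(ler0z algC) eP mulr_ge0 // ler0z ltW //.
  - rewrite mulN1r lez0_abs ?opprK // -(lerz0 algC) eP.
    by rewrite mulr_le0_ge0 // lerz0 ltW.
have F0 : F 0%N = (f.[1])%:~R by rewrite /F expr0 -hornerC.
have [i iq|P P0 eP] := @prod_conj_sym q (fun i => F i.+1).
  by rewrite -FJ ?subSS ?subnSK // ltnW.
exists P => //; rewrite RE big_ord_recl -/(F 0%N) F0 eP /c rmorphM -[RHS]mulrA.
congr (_ * (_ * _)); rewrite /=; case: (boolP (odd q)) => oddq //=.
rewrite -hornerC /F rmorphN rmorph1; congr _.[_].
(* The middle power w^((q+1)/2) squares to 1 and differs from 1, as w has order q+1; hence it is
   -1. *)
have qE : (q./2.+1 * 2 = q.+1)%N.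
  by rewrite muln2 doubleS -[in RHS](odd_double_half q) oddq.
have /eqP : (w ^+ q./2.+1) ^+ 2 = 1 by rewrite -exprM qE (prim_expr_order prw).
rewrite sqrf_eq1 => /orP[|/eqP //].
rewrite -(prim_order_dvd prw) => /dvdn_leq.
by move/(_ isT); rewrite -qE leqNgt ltn_Pmulr.
Qed.

(** * Divisibility by p^n when p divides f(1) *)

Lemma Aint_horner (f : {poly int}) (z : algC) :
  z \in Aint -> (algC_poly f).[z] \in Aint.
Proof.
move=> zA; rewrite horner_coef; apply: rpred_sum => i _.
by rewrite coef_map rpredM ?Aint_int // rpredX.
Qed.

(* If z has order p then p = \sum_(k < p) (1 - z^k); in general 1 - z divides
   1 - z^p. *)
Lemma Aint_div_1subr (p n : nat) (z : algC) : (0 < p)%N ->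
  z ^+ (p ^ n) = 1 -> z != 1 -> p%:R / (1 - z) \in Aint.
Proof.
move=> p0; elim: n z => [|n IHn] z; first by rewrite expr1 => ->; rewrite eqxx.
move=> zn z1; have z1' : 1 - z != 0 by rewrite subr_eq0 eq_sym.
have zA : z \in Aint.
  by apply: (@Aint_unity_root (p ^ n.+1)); rewrite ?expn_gt0 ?p0 //; apply/unity_rootP.
have geomA k : (1 - z ^+ k) / (1 - z) \in Aint.
  rewrite -opprB subrX1 -mulNr opprB mulrAC divff // mul1r.
  by apply: rpred_sum => i _; apply: rpredX.
have [zp|zp] := eqVneq (z ^+ p) 1; last first.
  have -> : p%:R / (1 - z) = p%:R / (1 - z ^+ p) * ((1 - z ^+ p) / (1 - z)).
    by rewrite mulrA divfK // subr_eq0 eq_sym.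
  by rewrite rpredM ?IHn // -exprM -expnS.
have -> : p%:R = \sum_(k < p) (1 - z ^+ k) :> algC.
  rewrite big_split /= sumr_const card_ord sumrN.
  have /eqP : (z - 1) * \sum_(k < p) z ^+ k = 0 by rewrite -subrX1 zp subrr.
  by rewrite mulf_eq0 subr_eq0 (negPf z1) => /eqP ->; rewrite subr0.
by rewrite mulr_suml; apply: rpred_sum => k _; apply: geomA.
Qed.

(** Both sides are the value at 1 of (t^(q+1) - 1) / (t - 1) = 1 + t + ... + t^q. *)
Lemma prod_1subr_prim_root (q : nat) (w : algC) :
  q.+1.-primitive_root w -> \prod_(i < q) (1 - w ^+ i.+1) = q.+1%:R.
Proof.
move=> prw; have := factor_Xn_sub_1 prw; rewrite subrX1 big_mkord big_ord_recl expr0.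
rewrite -polyC1 => /(mulfI (negbT (polyXsubC_eq0 1)))/(congr1 (horner^~ 1)).
rewrite horner_prod horner_sum /= => e.
transitivity (\prod_(i < q) ('X - (w ^+ lift ord0 i)%:P).[1]).
  by apply: eq_bigr => i _; rewrite !hornerE.
rewrite e (eq_bigr (fun=> 1)) => [|i _]; last by rewrite hornerXn expr1n.
by rewrite sumr_const card_ord.
Qed.

Lemma cres_dvd (p n : nat) (f : {poly int}) :
  prime p -> (p%:Z %| f.[1])%Z -> ((p ^ n)%N%:Z %| cres (p ^ n) f)%Z.
Proof.
move=> pr_p pf1; have p0 := prime_gt0 pr_p.
have : (0 < p ^ n)%N by rewrite expn_gt0 p0.
case qE: (p ^ n)%N => [|q] // _.
have [w prw RE] := cres_prim_root q f; set fC := algC_poly f in RE.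
have wA i : w ^+ i \in Aint by rewrite rpredX // (Aint_prim_root prw).
have [g fE] : exists g, f - f.[1]%:P = g * ('X - 1%:P).
  by apply/factor_theorem; rewrite rootE !hornerE subrr.
have [a f1E] := dvdzP pf1.
(* Here f(z) / (1 - z) = f(1) / (1 - z) - g(z), where p divides f(1) and p / (1 - z) is integral. *)
have fwA (i : 'I_q) : fC.[w ^+ i.+1] / (1 - w ^+ i.+1) \in Aint.
  have w1 : w ^+ i.+1 != 1.
    by rewrite -(prim_order_dvd prw) gtnNdvd // ltnS ltn_ord.
  have -> : fC = algC_poly g * ('X - 1%:P) + (f.[1]%:~R)%:P.
    apply/eqP; rewrite -subr_eq; apply/eqP; move/(congr1 algC_poly): fE.
    by rewrite rmorphB rmorphM rmorphB /= map_polyX !map_polyC rmorph1.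
  rewrite !hornerE f1E rmorphM mulrDl -opprB mulrN mulNr -!mulrA.
  rewrite divff ?subr_eq0 1?eq_sym // mulr1 rpredD ?rpredN ?Aint_horner //.
  rewrite rpredM ?Aint_int // (@Aint_div_1subr p n) //.
  by rewrite -exprM mulnC exprM qE (prim_expr_order prw) expr1n.
(* The root 1 contributes f(1); dividing each other factor by its 1 - z uses up q+1 = p^n. The
   quotient is also rational, hence an integer. *)
have RA : (cres q.+1 f)%:~R / q.+1%:R \in Aint.
  rewrite RE big_ord_recl expr0 -(prod_1subr_prim_root prw) -mulrA -prodf_div.
  rewrite rpredM ?Aint_horner ?Aint1 //.
  by apply: rpred_prod => i _; apply: fwA.
have /Cint_rat_Aint/(_ RA)/intrP[b bE] : (cres q.+1 f)%:~R / q.+1%:R \in Crat.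
  by rewrite rpred_div ?rpred_int ?rpred_nat.
apply/dvdzP; exists b; apply: (@intr_inj algC).
by rewrite rmorphM /= -bE divfK // pnatr_eq0.
Qed.

(** * Congruences between consecutive resultants *)

Lemma cres_expnE (p n : nat) (f : {poly int}) : prime p ->
  exists2 q, q.+1 = (p ^ n)%N & cres (p ^ n) f = \det (circulant q f).
Proof.
move=> /prime_gt0 p0; exists (p ^ n).-1; first by rewrite prednK ?expn_gt0 ?p0.
by rewrite -cres_circulant prednK ?expn_gt0 ?p0.
Qed.

Lemma cres_congr (p n : nat) (f : {poly int}) : prime p ->
  (`|cres (p ^ n.+1) f| = `|cres (p ^ n) f| %[mod p ^ n.+1])%N.
Proof.
move=> pr_p; have [q qE ->] := cres_expnE n.+1 f pr_p.
have [q' q'E ->] := cres_expnE n f pr_p.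
set a := \det _; set b := \det _.
(* The factor p^(n+1) covers zero determinants, the maxima keep m nonzero. *)
pose m := (p ^ n.+1 * (maxn 1 `|a| * maxn 1 `|b|))%N.
have m1 : (1 < m)%N.
  have p1 : (1 < p ^ n.+1)%N by rewrite -(exp1n n.+1) ltn_exp2r // prime_gt1.
  by rewrite (leq_trans p1) // leq_pmulr // muln_gt0 !leq_maxl.
have maxE (x : int) : x != 0 -> maxn 1 `|x| = `|x|%N.
  by move=> x0; apply/maxn_idPr; rewrite absz_gt0.
have rm : (p ^ n.+1 %| m)%N by apply: dvdn_mulr.
have am : (a != 0 -> `|a| %| m)%N.
  by move/maxE=> e; rewrite dvdn_mull // dvdn_mulr // e.
have bm : (b != 0 -> `|b| %| m)%N.
  by move/maxE=> e; rewrite dvdn_mull // dvdn_mull // e.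
rewrite (card_solutions_mod m1 rm am) (card_solutions_mod m1 rm bm).
exact: card_solutions_circulant.
Qed.

Lemma cres_part_congr (p n : nat) (f : {poly int}) (pi : nat_pred) : prime p ->
  cres (p ^ n.+1) f != 0 -> cres (p ^ n) f != 0 ->
  (`|cres (p ^ n.+1) f|`_pi = `|cres (p ^ n) f|`_pi %[mod p ^ n.+1])%N.
Proof.
move=> pr_p; have [q qE ->] := cres_expnE n.+1 f pr_p.
have [q' q'E ->] := cres_expnE n f pr_p.
set a := \det _; set b := \det _ => a0 b0.
pose m := (`|a|`_pi * `|b|`_pi)%N.
have : (0 < m)%N by rewrite muln_gt0 !part_gt0.
(* Counting requires 1 < m; for m = 1 both pi-parts are 1. *)
rewrite leq_eqVlt => /orP[/eqP/esym/eqP|m1].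
  by rewrite muln_eq1 => /andP[/eqP -> /eqP ->].
have pim : pi.-nat m by rewrite pnatM !part_pnat.
rewrite -(card_solutions_part m1 a0 pim) ?dvdn_mulr //.
rewrite -(card_solutions_part m1 b0 pim) ?dvdn_mull //.
exact: card_solutions_circulant.
Qed.

(** * Limits in the p-adic integers *)

Lemma eqz_mod_dvdW (d e a b : int) :
  (d %| e)%Z -> (a = b %[mod e])%Z -> (a = b %[mod d])%Z.
Proof.
move=> de /eqP; rewrite eqz_mod_dvd => /(dvdz_trans de) dab.
by apply/eqP; rewrite eqz_mod_dvd.
Qed.

(** From index k on the sequence is constant modulo p^k, so a k supplies the k-th component.
    Comparison starts at index 1 because a 0 may have another sign; for k = 0 the modulus is 1. *)
Lemma padic_lim_cauchy (p : nat) (a : nat -> int) : (0 < p)%N ->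
  (forall n, (a n.+2 = a n.+1 %[mod (p ^ n.+2)%N%:Z])%Z) ->
  padic_lim p a (fun k => (a k %% (p ^ k)%N%:Z)%Z).
Proof.
move=> p0 acong.
have pk0 k : (p ^ k)%N%:Z != 0 by rewrite -lt0n expn_gt0 p0.
have acongr n k : (k <= n)%N -> (a n.+1 = a n %[mod (p ^ k)%N%:Z])%Z.
  case: n => [|n] le_kn.
    by move: le_kn; rewrite leqn0 => /eqP ->; rewrite !modz1.
  apply: eqz_mod_dvdW (acong n); apply: dvdn_exp2l; exact: leqW.
split=> k; last first.
  exists k => n /subnK <-; rewrite modz_mod; elim: (n - k)%N => // j IHj.
  by rewrite addSn acongr ?leq_addl.
rewrite modz_ge0 // ltz_pmod ?ltz_nat ?expn_gt0 ?p0 //; split=> //.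
rewrite modz_mod -(acongr k k) //; apply: (@eqz_mod_dvdW _ (p ^ k.+1)%N%:Z).
  by apply: dvdn_exp2l.
exact: modz_mod.
Qed.

Lemma nonp_partE (p : nat) (x : int) : prime p ->
  x != 0 -> nonp_part p x = sgz x * (`|x|`_p^')%N%:Z.
Proof.
move=> pr_p x0; rewrite /nonp_part -p_part {1}(intEsg x).
rewrite -{1}(partnC p (_ : 0 < `|x|)%N) ?absz_gt0 // [(_ * _)%N]mulnC PoszM mulrA.
by rewrite mulzK // -lt0n part_gt0.
Qed.

Theorem theorem4p3 (p : nat) (f : {poly int}) :
  prime p -> f != 0 ->
  (exists x, padic_lim p (fun n => cres (p ^ n) f) x /\
     (Zp_zero x <-> (p%:Z %| f.[1])%Z))
  /\
  ((forall n : nat, cres (p ^ n) f != 0) ->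
     (exists x, padic_lim p (fun n => nonp_part p (cres (p ^ n) f)) x /\ ~ Zp_zero x)
     /\
     (forall l : nat, prime l ->
        exists x, padic_lim p (fun n => l_part l (cres (p ^ n) f)) x /\
          (l != p -> ~ Zp_zero x) /\
          (l = p -> (Zp_zero x <-> (p%:Z %| f.[1])%Z)))).
Proof.
move=> pr_p _; have p0 := prime_gt0 pr_p.
have [s sE] := cres_sign f pr_p.
have modzM (x y : nat) (d : nat) (t : int) : (x = y %[mod d])%N ->
    (t * x = t * y %[mod d])%Z.
  by move=> e; rewrite -modzMmr modz_nat e -modz_nat modzMmr.
have cres1 : cres (p ^ 0) f = f.[1].
  rewrite expn0; have [w prw] := cres_prim_root 0 f.
  by rewrite big_ord1 expr0 -[1]/(1%:~R) horner_map => /intr_inj.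
(* This decides whether the component at k = 1 vanishes: modulo p the resultants of orders p and 1
   agree up to sign. *)
have p_cres1 : (p ^ 1 %| `|cres (p ^ 1) f|)%N = (p%:Z %| f.[1])%Z.
  by have := cres_congr 0 f pr_p; rewrite cres1 /dvdn => ->; rewrite expn1.
split.
  eexists; split.
    apply: padic_lim_cauchy => // n; rewrite sE [in RHS]sE.
    by apply: modzM; apply: cres_congr.
  split=> [/(_ 1%N) /dvdz_mod0P|pf1 k]; first by rewrite -p_cres1.
  by apply/dvdz_mod0P; apply: cres_dvd.
move=> cres0; split.
  (* The sign of the nonzero resultant is s, by cancelling its absolute value. *)
  have nonpE n : nonp_part p (cres (p ^ n.+1) f) = s * (`|cres (p ^ n.+1) f|`_p^')%N%:Z.
    rewrite nonp_partE //; congr (_ * _).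
    apply: (@mulIf _ `|cres (p ^ n.+1) f|%N%:Z); first by rewrite -lt0n absz_gt0.
    by rewrite -intEsg -sE.
  eexists; split.
    apply: padic_lim_cauchy => // n; rewrite !nonpE.
    by apply: modzM; apply: cres_part_congr.
  (* The component at k = 1 is the residue of a number prime to p, hence nonzero. *)
  move/(_ 1%N)/dvdz_mod0P; rewrite nonp_partE //.
  rewrite dvdzE abszM -sgrz absz_sg cres0 mul1n [X in (X %| _)%N]expn1 => pdvd.
  by have := part_pnat p^' `|cres (p ^ 1) f|; rewrite p'natE // pdvd.
move=> l pr_l.
have lE n : l_part l (cres (p ^ n) f) = 1 * (`|cres (p ^ n) f|`_l)%N%:Z.
  by rewrite /l_part -p_part mul1r.
eexists; split.
  apply: padic_lim_cauchy => // n; rewrite !lE.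
  by apply: modzM; apply: cres_part_congr.
split=> [neq_lp|->].
  move/(_ 1%N)/dvdz_mod0P; rewrite dvdzE /= [X in (X %| _)%N]expn1 Euclid_dvdX //.
  by rewrite dvdn_prime2 // eq_sym (negPf neq_lp).
split=> [/(_ 1%N) /dvdz_mod0P|pf1 k].
  by rewrite -p_cres1 dvdzE /= -p_part => /dvdn_trans; apply; apply: dvdn_part.
(* Since p^k divides the nonzero resultant of order p^k, it divides its p-part as well. *)
apply/dvdz_mod0P; rewrite dvdzE /= dvdn_exp2l //.
by rewrite -pfactor_dvdn ?absz_gt0 //; apply: cres_dvd.
Qed.
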